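(* Let $G$ be a group and $\alpha$ an endomorphism of $G$. Then every idempotent-separating congruence on the Bruck–Reilly extension $BR(G,\alpha)$ is perfect.
   Context: $\mathbb{N}$ denotes the set of all nonnegative integers. Mappings are written on the right and composed left to right. For a group $G$ and an endomorphism $\alpha$ of $G$, the Bruck–Reilly extension $BR(G,\alpha)$ is the set $\mathbb{N}\times G\times\mathbb{N}$ with multiplication $(m,g,n)(p,h,q)=(m+p-r,\,(g\alpha^{p-r})(h\alpha^{n-r}),\,n+q-r)$, where $r=\min\{n,p\}$ and $\alpha^0$ is the identity automorphism of $G$. It is an inverse semigroup with identity $(0,e_G,0)$ (where $e_G$ is the identity of $G$), with idempotents $(n,e_G,n)$, $n\in\mathbb{N}$, and with inverses $(m,g,n)^{-1}=(n,g^{-1},m)$. A congruence $\varepsilon$ on an inverse semigroup $S$ is idempotent-separating if $(e,f)\in\varepsilon$ implies $e=f$ for all idempotents $e,f$ of $S$. For a congruence $\varepsilon$ on a semigroup $S$ and $x\in S$, $x\varepsilon$ denotes the $\varepsilon$-class of $x$. For $A,B\subseteq S$, $AB=\{ab:a\in A,\ b\in B\}$. The congruence $\varepsilon$ is perfect if $(x\varepsilon)(y\varepsilon)=(xy)\varepsilon$ (equality of subsets of $S$) for all $x,y\in S$. *)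

(* Defs.v *)
From HB Require Import structures.
From mathcomp Require Import all_boot zify.
From mathcomp Require Import boolp classical_sets.

Set Implicit Arguments.
Unset Strict Implicit.
Unset Printing Implicit Defensive.

Local Open Scope group_scope.
Local Open Scope classical_set_scope.

(* The argument [alpha] is unused in the body: it selects the multiplication.
   [groupType] covers infinite groups, and a multiplicative map between groups
   is a group homomorphism. *)
Definition BR (G : groupType) (alpha : {multiplicative G -> G}) : Type :=
  (nat * G * nat)%type.

Section BruckReilly.
Variables (G : groupType) (alpha : {multiplicative G -> G}).

(* The subtractions below are never truncated, since [r] is at most [n] and
   [p]. *)
Definition BR_mul (x y : BR alpha) : BR alpha :=
  let: (m, g, n) := x in
  let: (p, h, q) := y in
  let r := minn n p in
  ((m + p - r)%N, iter (p - r) alpha g * iter (n - r) alpha h, (n + q - r)%N).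

Definition BR_one : BR alpha := (0%N, 1, 0%N).

Lemma iter_mulg k (g h : G) :
  iter k alpha (g * h) = iter k alpha g * iter k alpha h.
Proof. by elim: k => //= k ->; rewrite gmulfM. Qed.

Lemma iter_one k : iter k alpha 1 = 1.
Proof.
by elim: k => //= k ->; apply: (mulgI (alpha 1)); rewrite -gmulfM !mulg1.
Qed.

Lemma BR_mulA : associative BR_mul.
Proof.
move=> [[m g] n] [[p h] q] [[s k] t] /=.
rewrite !iter_mulg -!iterD mulgA.
congr (_, iter _ _ _ * iter _ _ _ * iter _ _ _, _); lia.
Qed.

Lemma BR_mul1 : left_id BR_one BR_mul.
Proof.
by move=> [[m g] n] /=; rewrite min0n !subn0 add0n iter_one mul1g.
Qed.

Lemma BR_mulr1 : right_id BR_one BR_mul.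
Proof.
by move=> [[m g] n] /=; rewrite minn0 !subn0 !addn0 iter_one mulg1.
Qed.

HB.instance Definition _ := Choice.copy (BR alpha) (nat * G * nat)%type.
HB.instance Definition _ := isMonoid.Build (BR alpha) BR_mulA BR_mul1 BR_mulr1.

End BruckReilly.

Section Congruences.
Variable S : semigroupType.
Implicit Types eps : S -> S -> Prop.

Definition congruence eps : Prop :=
  RelationClasses.Equivalence eps /\
  forall x x' y y', eps x x' -> eps y y' -> eps (x * y) (x' * y').

Definition idempotent (e : S) : Prop := e * e = e.

Definition idempotent_separating eps : Prop :=
  forall e f, idempotent e -> idempotent f -> eps e f -> e = f.

Definition eps_class eps (x : S) : set S := [set y | eps x y].

Definition set_mul (A B : set S) : set S := [set a * b | a in A & b in B].

Definition perfect eps : Prop :=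
  forall x y, set_mul (eps_class eps x) (eps_class eps y) =
              eps_class eps (x * y).

End Congruences.

(* Main.v *)
Require Import Defs.
From mathcomp Require Import all_boot.
From mathcomp Require Import zify.
From mathcomp Require Import classical_sets.

(** An idempotent-separating congruence never relates elements with different
    outer coordinates ([idempotent_separating_coords]).  So an element [z]
    related to [x * y] has the outer coordinates of [x * y], and this makes
    division possible inside the product.  Write [n] for the right coordinate
    of [x] and [p] for the left coordinate of [y].  If [p <= n], then the
    idempotent [y * y^-1] is a right identity for [x] and [y^-1 * y] is one
    for [z]; hence [z = (z * y^-1) * y], where [z * y^-1] is related to
    [x * y * y^-1 = x].  If [n <= p], the mirror factorization
    [z = x * (x^-1 * z)] works.  In both cases one of the two factors does not
    move.  The reverse inclusion holds for every congruence. *)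

Set Implicit Arguments.
Unset Strict Implicit.
Unset Printing Implicit Defensive.

Local Open Scope group_scope.
Local Open Scope classical_set_scope.

Section BruckReillyInverse.
Variables (G : groupType) (alpha : {multiplicative G -> G}).
Implicit Types x y z : BR alpha.

Definition BR_left x : nat := x.1.1.
Definition BR_right x : nat := x.2.
Definition BR_inv x : BR alpha := (x.2, x.1.2^-1, x.1.1).
Definition BR_idem (k : nat) : BR alpha := (k, 1, k).

Lemma BR_leftM x y :
  BR_left (x * y) = (BR_left x + BR_left y - minn (BR_right x) (BR_left y))%N.
Proof. by case: x => [[m g] n]; case: y => [[p h] q]. Qed.

Lemma BR_rightM x y :
  BR_right (x * y) = (BR_right x + BR_right y - minn (BR_right x) (BR_left y))%N.
Proof. by case: x => [[m g] n]; case: y => [[p h] q]. Qed.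

Lemma BR_mulV x : x * BR_inv x = BR_idem (BR_left x).
Proof.
case: x => [[m g] n]; rewrite /mul /= /BR_idem /BR_left /=.
by rewrite minnn subnn /= mulgV addnK addKn.
Qed.

Lemma BR_mulVl x : BR_inv x * x = BR_idem (BR_right x).
Proof.
case: x => [[m g] n]; rewrite /mul /= /BR_idem /BR_right /=.
by rewrite minnn subnn /= mulVg addnK addKn.
Qed.

Lemma BR_mul_idem k x : (k <= BR_right x)%N -> x * BR_idem k = x.
Proof.
case: x => [[m g] n]; rewrite /BR_right /mul /= => le_kn.
by rewrite (minn_idPr le_kn) subnn iter_one mulg1 !addnK.
Qed.

Lemma BR_idem_mul k x : (k <= BR_left x)%N -> BR_idem k * x = x.
Proof.
case: x => [[m g] n]; rewrite /BR_left /mul /= => le_km.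
by rewrite (minn_idPl le_km) subnn iter_one mul1g !addKn.
Qed.

Lemma BR_idem_idempotent k : Defs.idempotent (BR_idem k).
Proof. exact: BR_mul_idem. Qed.

End BruckReillyInverse.

Section Congruence.
Variables (G : groupType) (alpha : {multiplicative G -> G}).
Variable eps : BR alpha -> BR alpha -> Prop.
Hypothesis eps_cong : congruence eps.
Implicit Types x y z : BR alpha.

Let eps_refl x : eps x x. Proof. by case: eps_cong => [[]]. Qed.

Let eps_sym x y : eps x y -> eps y x.
Proof. by case: eps_cong => [[_ + _] _]; apply. Qed.

Let eps_trans x y z : eps x y -> eps y z -> eps x z.
Proof. by case: eps_cong => [[_ _ +] _]; apply. Qed.

Let eps_mul x x' y y' : eps x x' -> eps y y' -> eps (x * y) (x' * y').
Proof. by case: eps_cong => _; apply. Qed.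

Hypothesis eps_sep : idempotent_separating eps.

(** If the left coordinate [p] of [y] exceeded that [m] of [x], the idempotent
    [(p, 1, p)] would fix [y], hence fix [x] up to [eps]; cancelling [x] on the
    right would relate the distinct idempotents [(m, 1, m)] and [(p, 1, p)]. *)
Lemma eps_left_le x y : eps x y -> (BR_left y <= BR_left x)%N.
Proof.
move=> xy; rewrite leqNgt; apply/negP => lt_xy.
have fix_x : eps (BR_idem alpha (BR_left y) * x) x.
  apply: eps_trans (eps_mul (eps_refl _) xy) _.
  by rewrite BR_idem_mul //; apply: eps_sym.
have := eps_mul fix_x (eps_refl (BR_inv x)).
rewrite -mulgA BR_mulV BR_mul_idem; last exact: ltnW.
move/(eps_sep (BR_idem_idempotent _ _) (BR_idem_idempotent _ _)).
by case=> eq_xy; rewrite eq_xy ltnn in lt_xy.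
Qed.

Lemma eps_right_le x y : eps x y -> (BR_right y <= BR_right x)%N.
Proof.
move=> xy; rewrite leqNgt; apply/negP => lt_xy.
have fix_x : eps (x * BR_idem alpha (BR_right y)) x.
  apply: eps_trans (eps_mul xy (eps_refl _)) _.
  by rewrite BR_mul_idem //; apply: eps_sym.
have := eps_mul (eps_refl (BR_inv x)) fix_x.
rewrite mulgA BR_mulVl BR_idem_mul; last exact: ltnW.
move/(eps_sep (BR_idem_idempotent _ _) (BR_idem_idempotent _ _)).
by case=> eq_xy; rewrite eq_xy ltnn in lt_xy.
Qed.

Lemma idempotent_separating_coords x y :
  eps x y -> BR_left x = BR_left y /\ BR_right x = BR_right y.
Proof.
move=> xy; have yx := eps_sym xy.
by split; apply/eqP; rewrite eqn_leq ?eps_left_le ?eps_right_le.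
Qed.

Lemma idempotent_separating_perfect : perfect eps.
Proof.
move=> x y; apply/seteqP; split=> [_ [a xa [b yb <-]]|z xyz].
  exact: eps_mul.
have [] := idempotent_separating_coords xyz.
rewrite BR_leftM BR_rightM => left_z right_z.
have [le_yx|/ltnW le_xy] := leqP (BR_left y) (BR_right x).
- exists (z * BR_inv y); last first.
    exists y; first exact: eps_refl.
    by rewrite -mulgA BR_mulVl BR_mul_idem //; lia.
  have := eps_mul xyz (eps_refl (BR_inv y)).
  by rewrite -[x * y * _]mulgA BR_mulV BR_mul_idem.
- exists x; first exact: eps_refl.
  exists (BR_inv x * z); last first.
    by rewrite mulgA BR_mulV BR_idem_mul //; lia.
  have := eps_mul (eps_refl (BR_inv x)) xyz.
  by rewrite [BR_inv x * (x * y)]mulgA BR_mulVl BR_idem_mul.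
Qed.

End Congruence.

Theorem theorem3p2 (G : groupType) (alpha : {multiplicative G -> G})
    (eps : BR alpha -> BR alpha -> Prop) :
  congruence eps -> idempotent_separating eps -> perfect eps.
Proof. exact: idempotent_separating_perfect. Qed.
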